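(* Let $q$ be a prime power. If $q\neq 2$, then there is a nonsingular irreducible $\mathbb{P}^1\times\mathbb{P}^1$-filling curve over $\mathbb{F}_q$ of bi-degree $(q+1,q+1)$.
   Context: $\mathbb{F}_q$ is the finite field with $q$ elements. A curve on $\mathbb{P}^1\times\mathbb{P}^1$ over $\mathbb{F}_q$ of bi-degree $(a,b)$ is the zero locus $C$ of a nonzero polynomial $F(X_0,X_1;Y_0,Y_1)\in\mathbb{F}_q[X_0,X_1,Y_0,Y_1]$ that is homogeneous of degree $a$ in $X_0,X_1$ (coordinates of the first factor) and homogeneous of degree $b$ in $Y_0,Y_1$ (coordinates of the second factor). The curve is irreducible if $F$ is irreducible. It is nonsingular if, over an algebraic closure of $\mathbb{F}_q$, the corresponding scheme $F=0$ has no singular point; this is guaranteed if $F$ and its four partial derivatives with respect to $X_0,X_1,Y_0,Y_1$ have no common zero on $\mathbb{P}^1\times\mathbb{P}^1$ over the algebraic closure. $C$ is called a $\mathbb{P}^1\times\mathbb{P}^1$-filling curve over $\mathbb{F}_q$ if its set of $\mathbb{F}_q$-points satisfies $C(\mathbb{F}_q)=\mathbb{P}^1(\mathbb{F}_q)\times\mathbb{P}^1(\mathbb{F}_q)$. *)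

(* Defs.v *)
From HB Require Import structures.
From mathcomp Require Import all_boot all_order all_algebra all_field.
From mathcomp Require Export mpoly.

Set Implicit Arguments.
Unset Strict Implicit.
Unset Printing Implicit Defensive.

Import GRing.Theory.
Local Open Scope ring_scope.

(* The coordinate ring of P^1 x P^1 is {mpoly R[2 + 2]}: the variables X_0, X_1 *)
(* of the first factor are those of index [lshift 2 i], the variables Y_0, Y_1  *)
(* of the second factor those of index [rshift 2 j].                            *)

Definition bihomogeneous (R : nzRingType) (a b : nat) (f : {mpoly R[2 + 2]}) :=
  forall m : 'X_{1..2 + 2}, m \in msupp f ->
    (\sum_(i < 2) m (lshift 2 i) = a)%N /\ (\sum_(j < 2) m (rshift 2 j) = b)%N.

Definition curve_of_bidegree (R : nzRingType) (a b : nat)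
    (f : {mpoly R[2 + 2]}) :=
  f != 0 /\ bihomogeneous a b f.

Definition irreducible_elt (R : idomainType) (f : R) :=
  f \isn't a GRing.unit /\
  forall g h : R, f = g * h -> g \is a GRing.unit \/ h \is a GRing.unit.

(* A point of P^1(R) is given by homogeneous coordinates, a nonzero row vector; *)
(* vanishing at a point does not depend on them when f is bihomogeneous.        *)
Definition on_curve (R : comNzRingType) (f : {mpoly R[2 + 2]})
    (x y : 'rV[R]_2) :=
  f.@[row_mx x y 0] = 0.

Definition filling (F : fieldType) (f : {mpoly F[2 + 2]}) :=
  forall x y : 'rV[F]_2, x != 0 -> y != 0 -> on_curve f x y.

(* The equation of the curve in the standard affine chart X_i != 0, Y_j != 0 of *)
(* P^1 x P^1: set X_i = Y_j = 1 and keep the other X and the other Y variable   *)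
(* as the coordinates 'X_0 and 'X_1 of the affine plane.                        *)
Definition chart_subst (R : comNzRingType) (i j : 'I_2) (k : 'I_(2 + 2)) :
    {mpoly R[2]} :=
  match split k with
  | inl i' => if i' == i then 1 else 'X_0
  | inr j' => if j' == j then 1 else 'X_1
  end.

Definition dehomogenize (R : comNzRingType) (i j : 'I_2)
    (f : {mpoly R[2 + 2]}) : {mpoly R[2]} :=
  f \mPo [tuple chart_subst R i j k | k < 2 + 2].

(* Jacobian criterion for the affine plane curve g = 0.                         *)
Definition affine_singular_point (K : fieldType) (g : {mpoly K[2]})
    (p : 'I_2 -> K) :=
  g.@[p] = 0 /\ forall l : 'I_2, (mderiv l g).@[p] = 0.

(* Here (K, iota) ranges over the algebraic closures of F: K is algebraically   *)
(* closed and every element of K is algebraic over iota(F).                     *)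
Definition nonsingular (F : fieldType) (f : {mpoly F[2 + 2]}) :=
  forall (K : closedFieldType) (iota : {rmorphism F -> K}),
    integralRange iota ->
    forall (i j : 'I_2) (p : 'I_2 -> K),
      ~ affine_singular_point (dehomogenize i j (map_mpoly iota f)) p.

(* Main.v *)
Require Import Defs.
From mathcomp Require Import all_boot all_order all_algebra.
From mathcomp Require Import all_fingroup all_solvable all_field.
From mathcomp Require Import ring.

(** Write U(X) = X_0^q X_1 - X_1^q X_0. Since a^q = a on F_q, this form of degree
    q + 1 vanishes at every rational point of P^1, so a curve
      f = U(X) B(Y) + A(X) U(Y),
    with A and B of degree q + 1, passes through all the rational points of
    P^1 x P^1. The forms A and B are taken q-sesquilinear,
      A = X_0^(q+1) - (1 + g) X_0^q X_1 + g X_0 X_1^q - c X_1^(q+1),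
    and B the same with h in place of g. At rational points A and B restrict to
    the quadratic form Q = X_0^2 - X_0 X_1 - c X_1^2, whatever g and h are, and
    c is chosen so that Q is anisotropic over F_q. The roots x of Q(x, 1) are
    then exchanged by Frobenius: x^q = 1 - x.

    Nonsingularity ([filling_form_smooth]). The derivative of a q-th power is 0,
    so the X-gradient of f is linear in X_0^q, X_1^q; at a singular point a
    combination of its two components reads U(Y) Q(X)^q = 0. If U(Y) = 0 then Y
    is rational and also B(Y) = 0, which Q anisotropic forbids; so Q(X) = 0, and
    likewise Q(Y) = 0. In affine coordinates f = 0 then becomes
    (x + y + g + h)^q = 0 with x, y roots of Q. Conjugating x and y shows that
    this happens only if g + h is 0 or -1 ([frob_roots_sum_neq0]), and for q > 2
    there are other elements in F_q.

    Irreducibility ([filling_poly_irreducible]). The projection to the second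
    factor has a totally ramified fibre over some y in the algebraic closure: if
    x is a root of Q and B(y) = (x^q + g) U(y), then f(X, y) is U(y) times
    (X_0 - x X_1)^(q+1) ([ramified_fibre]). Let f = r s. The factors are
    bihomogeneous. Were both of positive degree in X, both would vanish at (x, y),
    which would be a singular point of f; so one of them, say r, involves only Y.
    A zero of r would be a zero of f(X, Y) for every X, hence a common zero of
    U and B, and there is none; so r is a constant. *)

Section FillingCurve.

Set Implicit Arguments.
Unset Strict Implicit.
Unset Printing Implicit Defensive.

Import GRing.Theory.
Local Open Scope ring_scope.

(** * The forms in the coordinates of a point *)

Section Forms.
Variables (R : comNzRingType) (q : nat).

(** Up to sign the product of the linear forms over F_q, one for each rational
    point of the projective line. *)
Definition points_form (x0 x1 : R) := x0 ^+ q * x1 - x1 ^+ q * x0.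

(** The q-sesquilinear form with matrix [1, -(1 + g); g, -c]. On coordinates
    fixed by Frobenius only the symmetric part matters, and it is the quadratic
    form x0^2 - x0 x1 - c x1^2, independent of g. *)
Definition frob_form (g c x0 x1 : R) :=
  x0 ^+ q * x0 - (1 + g) * (x0 ^+ q * x1) + g * (x1 ^+ q * x0)
  - c * (x1 ^+ q * x1).

Definition filling_form (g h c x0 x1 y0 y1 : R) :=
  points_form x0 x1 * frob_form h c y0 y1 + frob_form g c x0 x1 * points_form y0 y1.
End Forms.

Section Frobenius.
Variables (K : comNzRingType) (q : nat).
Hypothesis char_q : [pchar K].-nat q.

Lemma frob0 : 0 ^+ q = 0 :> K.
Proof. by case/andP: char_q; rewrite expr0n; case: q. Qed.

Lemma frobD (x y : K) : (x + y) ^+ q = x ^+ q + y ^+ q.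
Proof. exact: exprDn_pchar. Qed.

Lemma frobN (x : K) : (- x) ^+ q = - x ^+ q.
Proof.
by apply/eqP; rewrite -addr_eq0 -frobD addNr frob0.
Qed.

Lemma frobB (x y : K) : (x - y) ^+ q = x ^+ q - y ^+ q.
Proof. by rewrite frobD frobN. Qed.

End Frobenius.

Section Field.
Variables (K : fieldType) (q : nat).
Hypothesis char_q : [pchar K].-nat q.
Variable c : K.
Hypothesis cq : c ^+ q = c.
Hypothesis noroot : forall x : K, x ^+ q = x -> x ^+ 2 - x - c != 0.

Local Notation L := (points_form q).
Local Notation A := (fun g => frob_form q g c).

Let q_gt0 : (0 < q)%N. Proof. by case/andP: char_q. Qed.

(** Frobenius permutes the roots x and 1 - x of the quadratic polynomial and
    cannot fix x. *)
Lemma frob_root (x : K) : x ^+ 2 - x - c = 0 -> x ^+ q = 1 - x.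
Proof.
move=> Qx; have Qxq : (x ^+ q) ^+ 2 - x ^+ q - c = 0.
  by rewrite -[in LHS]cq exprAC -!(frobB char_q) Qx (frob0 char_q).
have: (x ^+ q - x) * (x ^+ q + x - 1) = 0.
  by rewrite -[RHS](subrr 0) -{1}Qxq -Qx; ring.
move/eqP; rewrite mulf_eq0 => /orP[|/eqP xq].
  by rewrite subr_eq0 => /eqP /noroot; rewrite Qx eqxx.
by rewrite -[RHS]addr0 -xq; ring.
Qed.

(** A zero of the first form is proportional to a point fixed by Frobenius,
    where the second is the anisotropic quadratic form. *)
Lemma points_frob_form_coprime (g y0 y1 : K) :
  L y0 y1 = 0 -> A g y0 y1 = 0 -> y0 = 0 /\ y1 = 0.
Proof.
have [-> | y1N0] := eqVneq y1 0.
  rewrite /frob_form (frob0 char_q) => _ /eqP.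
  by rewrite !(mulr0, mul0r, addr0, subr0) mulf_eq0 expf_eq0 q_gt0 orbb => /eqP.
move=> Ly Ay; exfalso.
have y1qN0 : y1 ^+ q != 0 by rewrite expf_neq0.
have [t tq y0E] : exists2 t, t ^+ q = t & y0 = t * y1.
  exists (y0 / y1); last by rewrite divfK.
  rewrite expr_div_n; apply/eqP; rewrite eqr_div // -subr_eq0 -Ly /points_form.
  by apply/eqP; ring.
have /eqP := noroot tq; apply; apply: (mulIf (mulf_neq0 y1qN0 y1N0)).
rewrite mul0r -Ay /frob_form y0E exprMn tq; ring.
Qed.

(** Adding x + y + e = 0 and its image by Frobenius, (1 - x) + (1 - y) + e = 0,
    gives 2 (1 + e) = 0, so the characteristic is 2 as e differs from -1. Then
    x = y would give e = 0, and the other case x + y = 1 would give e = -1. *)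
Lemma frob_roots_sum_neq0 (e x y : K) : e ^+ q = e -> e != 0 -> e != -1 ->
  x ^+ 2 - x - c = 0 -> y ^+ 2 - y - c = 0 -> x + y + e != 0.
Proof.
move=> eq eN0 eN1 Qx Qy; apply/eqP=> xye.
have : (x + y + e) ^+ q = 0 by rewrite xye (frob0 char_q).
rewrite !(frobD char_q) (frob_root Qx) (frob_root Qy) eq => xye'.
have /eqP : 2 * (1 + e) = 0 by rewrite -[RHS]addr0 -{1}xye -xye'; ring.
rewrite mulf_eq0 [1 + e]addrC (addr_eq0 e) (negPf eN1) orbF => /eqP two0.
have : (x - y) * (x + y - 1) = 0 by rewrite -[RHS](subrr 0) -{1}Qx -Qy; ring.
move/eqP; rewrite mulf_eq0 => /orP[]; rewrite subr_eq0 => /eqP xy.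
  move/eqP: eN0; apply; rewrite -xye xy.
  have -> : y + y + e = 2 * y + e by ring.
  by rewrite two0 mul0r add0r.
by move/eqP: eN1; apply; apply/eqP; rewrite -addr_eq0 addrC -xy xye.
Qed.

(** The hypotheses say that both X-derivatives of the equation vanish, with b
    and v the values at Y of its two forms. Eliminating b leaves v times the
    q-th power of the quadratic form. *)
Lemma quad_of_gradient (g x0 x1 b v : K) : g ^+ q = g -> v != 0 ->
  v * (x0 ^+ q + g * x1 ^+ q) = b * x1 ^+ q ->
  v * ((1 + g) * x0 ^+ q + c * x1 ^+ q) = b * x0 ^+ q ->
  x0 ^+ 2 - x0 * x1 - c * x1 ^+ 2 = 0.
Proof.
move=> gq vN0 e0 e1; apply/eqP; suff: (x0 ^+ 2 - x0 * x1 - c * x1 ^+ 2) ^+ q == 0.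
  by rewrite expf_eq0 => /andP[].
rewrite !(frobB char_q) !exprMn cq -(inj_eq (mulfI vN0)) mulr0.
have: v * (x0 ^+ q + g * x1 ^+ q) * x0 ^+ q
      - v * ((1 + g) * x0 ^+ q + c * x1 ^+ q) * x1 ^+ q = 0.
  by rewrite e0 e1; ring.
by move=> <-; apply/eqP; ring.
Qed.

Lemma root_of_quad (x0 x1 : K) : (x0, x1) != (0, 0) ->
  x0 ^+ 2 - x0 * x1 - c * x1 ^+ 2 = 0 ->
  x1 != 0 /\ exists2 x, x ^+ 2 - x - c = 0 & x0 = x * x1.
Proof.
move=> xN0 Q0; have x1N0 : x1 != 0.
  apply: contraNneq xN0 => x1E; move/eqP: Q0.
  by rewrite x1E expr0n !(mulr0, subr0) expf_eq0 => /eqP ->.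
split=> //; exists (x0 / x1); last by rewrite divfK.
apply: (mulIf (expf_neq0 2 x1N0)); rewrite mul0r -Q0; field.
exact: x1N0.
Qed.

(** The last four hypotheses say that the partial derivatives of the equation
    vanish at the point: q-th powers being constants for derivations, each
    derivative is linear in the q-th powers of the coordinates. *)
Lemma filling_form_smooth (g h x0 x1 y0 y1 : K) :
  g ^+ q = g -> h ^+ q = h -> g + h != 0 -> g + h != -1 ->
  (x0, x1) != (0, 0) -> (y0, y1) != (0, 0) ->
  L y0 y1 * (x0 ^+ q + g * x1 ^+ q) = A h y0 y1 * x1 ^+ q ->
  L y0 y1 * ((1 + g) * x0 ^+ q + c * x1 ^+ q) = A h y0 y1 * x0 ^+ q ->
  L x0 x1 * (y0 ^+ q + h * y1 ^+ q) = A g x0 x1 * y1 ^+ q ->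
  L x0 x1 * ((1 + h) * y0 ^+ q + c * y1 ^+ q) = A g x0 x1 * y0 ^+ q ->
  False.
Proof.
move=> gq hq ghN0 ghN1 xN0 yN0 ex0 ex1 ey0 ey1.
(* If U vanished at a, the gradient at the other point b would make the
   sesquilinear form vanish at a as well. *)
have UvalN0 (e a0 a1 b0 b1 : K) : (a0, a1) != (0, 0) -> (b0, b1) != (0, 0) ->
    0 = A e a0 a1 * b1 ^+ q -> 0 = A e a0 a1 * b0 ^+ q -> L a0 a1 != 0.
  move=> aN0 bN0 e1 e0; apply/eqP=> La.
  have Aa : A e a0 a1 = 0.
    apply/eqP; apply: contraNT bN0 => AN0; move/esym/eqP: e1; move/esym/eqP: e0.
    by rewrite !mulf_eq0 (negPf AN0) !expf_eq0 q_gt0 => /eqP -> /eqP ->.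
  by have [a0E a1E] := points_frob_form_coprime La Aa;
    rewrite a0E a1E eqxx in aN0.
have VN0 : L y0 y1 != 0.
  apply/eqP=> V0; move: ex0 ex1; rewrite V0 !mul0r => e0 e1.
  by have := UvalN0 _ _ _ _ _ yN0 xN0 e0 e1; rewrite V0 eqxx.
have UN0 : L x0 x1 != 0.
  apply/eqP=> U0; move: ey0 ey1; rewrite U0 !mul0r => e0 e1.
  by have := UvalN0 _ _ _ _ _ xN0 yN0 e0 e1; rewrite U0 eqxx.
have [x1N0 [x Qx x0E]] := root_of_quad xN0 (quad_of_gradient gq VN0 ex0 ex1).
have [y1N0 [y Qy y0E]] := root_of_quad yN0 (quad_of_gradient hq UN0 ey0 ey1).
have ghq : (g + h) ^+ q = g + h by rewrite (frobD char_q) gq hq.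
have /negP := frob_roots_sum_neq0 ghq ghN0 ghN1 Qx Qy; apply.
suff : (x + y + (g + h)) ^+ q == 0 by rewrite expf_eq0 => /andP[].
rewrite !(frobD char_q) -(inj_eq (mulfI (mulf_neq0 (mulf_neq0 UN0 VN0)
  (mulf_neq0 (expf_neq0 q x1N0) (expf_neq0 q y1N0))))) mulr0.
(* Euler's relation is f = 0 as the degree q + 1 is 1 in K; the gradients then
   express the values of the two sesquilinear forms in it. *)
have : L x0 x1 * (A h y0 y1 * x1 ^+ q) * y1 ^+ q
     + (A g x0 x1 * y1 ^+ q) * L y0 y1 * x1 ^+ q = 0.
  have euler : L x0 x1 * A h y0 y1 + A g x0 x1 * L y0 y1 = 0.
    transitivity (x0 * (L y0 y1 * (x0 ^+ q + g * x1 ^+ q) - A h y0 y1 * x1 ^+ q)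
       - x1 * (L y0 y1 * ((1 + g) * x0 ^+ q + c * x1 ^+ q) - A h y0 y1 * x0 ^+ q)).
      by rewrite /points_form /frob_form; ring.
    by rewrite ex0 ex1 !subrr !mulr0 subr0.
  by rewrite -[RHS](mul0r (x1 ^+ q * y1 ^+ q)) -euler; ring.
have x0q : x0 ^+ q = x ^+ q * x1 ^+ q by rewrite x0E exprMn.
have y0q : y0 ^+ q = y ^+ q * y1 ^+ q by rewrite y0E exprMn.
by rewrite -ex0 -ey0 x0q y0q gq hq => <-; apply/eqP; ring.
Qed.

End Field.

(** * Weighted homogeneity of multivariate polynomials *)

Lemma coefCXn (R : nzRingType) (a : R) (e d : nat) :
  (a%:P * 'X^e)`_d = a *+ (e == d).
Proof. by rewrite mul_polyC coefZ coefXn mulr_natr eq_sym. Qed.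

(** Both factors can only have the root 0; stripped of their powers of 'X they
    become constants. *)
Lemma factors_of_monomial (R : idomainType) (p r : {poly R}) (a : R) (d : nat) :
  a != 0 -> p * r = a%:P * 'X^d ->
  exists i k b e, [/\ (i + k)%N = d, p = b%:P * 'X^i & r = e%:P * 'X^k].
Proof.
move=> aN0 prE; have prN0 : p * r != 0.
  by rewrite prE mulf_neq0 ?polyC_eq0 // expf_neq0 // polyX_eq0.
have /andP[pN0 rN0] : (p != 0) && (r != 0) by rewrite -negb_or -mulf_eq0.
have [i [p' /implyP/(_ pN0) p'0 pE]] := multiplicity_XsubC p 0.
have [k [r' /implyP/(_ rN0) r'0 rE]] := multiplicity_XsubC r 0.
rewrite subr0 in pE rE.
have prE' : (p' * r') * 'X^(i + k) = a%:P * 'X^d by rewrite -prE pE rE exprD; ring.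
have nz : (p' * r')`_0 != 0.
  by rewrite -horner_coef0 hornerM mulf_neq0.
have ikd : (i + k)%N = d.
  apply/eqP; case: ltngtP => // lt_d.
    have : (p' * r' * 'X^(i + k))`_(i + k) = (a%:P * 'X^d)`_(i + k) by rewrite prE'.
    by rewrite coefMXn ltnn subnn coefCXn gtn_eqF // => /eqP; rewrite (negPf nz).
  have : (p' * r' * 'X^(i + k))`_d = (a%:P * 'X^d)`_d by rewrite prE'.
  by rewrite coefMXn lt_d coefCXn eqxx => /esym/eqP; rewrite (negPf aN0).
have p'r'E : p' * r' = a%:P.
  by apply: (@mulIf _ 'X^d); rewrite ?expf_neq0 ?polyX_eq0 // -{1}ikd.
have : size (p' * r') == 1%N by rewrite p'r'E size_polyC aN0.
rewrite size_mul_eq1 => /andP[/size_poly1P[b _ bE] /size_poly1P[e _ eE]].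
by exists i, k, b, e; rewrite -bE -eE.
Qed.

Section Weights.
Variables (F : fieldType) (n : nat) (w : 'I_n -> nat).

Definition weight (m : 'X_{1..n}) := (\sum_k w k * m k)%N.

(** Neither of the two degrees of a bihomogeneous polynomial is the total degree:
    each is the degree for weights 1 on one pair of variables and 0 on the other. *)
Definition whomog (d : nat) (f : {mpoly F[n]}) :=
  forall m, m \in msupp f -> weight m = d.

(** The substitution 'X_k := 'X_k * t ^+ w k. It is a ring morphism that
    separates the weights, so that homogeneity is multiplicative. *)
Definition grading (f : {mpoly F[n]}) : {poly {mpoly F[n]}} :=
  mmap (polyC \o @mpolyC n F) (fun k => ('X_k)%:P * 'X^(w k)) f.

Lemma coef_grading f d m : ((grading f)`_d)@_m = f@_m *+ (weight m == d).
Proof.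
have mmapE m' : mmap1 (fun k => ('X_k)%:P * 'X^(w k)) m'
    = ('X_[m'] : {mpoly F[n]})%:P * 'X^(weight m').
  rewrite /mmap1 /weight mpolyXE_id rmorph_prod -prodrXr -big_split /=.
  by apply: eq_bigr => k _; rewrite exprMn -exprM rmorphXn.
rewrite /grading /mmap coef_sum raddf_sum /=.
have -> : f@_m *+ (weight m == d)
    = \sum_(m' <- msupp f) (f@_m *+ (weight m == d)) *+ (m' == m).
  have [mf | mf] := boolP (m \in msupp f); last first.
    by rewrite (memN_msupp_eq0 mf) mul0rn big1 // => m' _; rewrite mul0rn.
  rewrite (bigD1_seq m) //= eqxx big1 ?addr0 // => m' /negPf ->.
  by rewrite mulr0n.
apply: eq_bigr => m' _.
rewrite mmapE mulrA -polyCM coefCXn mcoeffMn mcoeffCM mcoeffX.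
by case: eqVneq => [-> | _]; rewrite ?mulr1 // mulr0 mul0rn.
Qed.

(** It is enough to know that the image is some monomial in t, which is what a
    factorization provides. *)
Lemma whomog_of_monomial d (f u : {mpoly F[n]}) :
  grading f = u%:P * 'X^d -> whomog d f.
Proof.
move=> fE m mf; have := coef_grading f (weight m) m; rewrite eqxx fE coefCXn.
case: eqVneq => // _ /esym/eqP.
by rewrite mulr0n mcoeff0 mcoeff_eq0 mf.
Qed.

Lemma grading_whomog d f : whomog d f -> grading f = f%:P * 'X^d.
Proof.
move=> fd; apply/polyP => d'; apply/mpolyP => m.
rewrite coef_grading coefCXn mcoeffMn.
have [mf | mf] := boolP (m \in msupp f); first by rewrite (fd _ mf).
by rewrite (memN_msupp_eq0 mf) !mul0rn.
Qed.

Lemma whomogP d f : whomog d f <-> grading f = f%:P * 'X^d.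
Proof. by split; [apply: grading_whomog | apply: whomog_of_monomial]. Qed.

Lemma whomogD d f h : whomog d f -> whomog d h -> whomog d (f + h).
Proof.
by rewrite !whomogP /grading => fd hd; rewrite rmorphD /= fd hd rmorphD mulrDl.
Qed.

Lemma whomogN d f : whomog d f -> whomog d (- f).
Proof. by rewrite !whomogP /grading => fd; rewrite rmorphN /= fd rmorphN mulNr. Qed.

Lemma whomogB d f h : whomog d f -> whomog d h -> whomog d (f - h).
Proof. by move=> fd hd; apply/whomogD/whomogN. Qed.

Lemma whomogM d e f h : whomog d f -> whomog e h -> whomog (d + e) (f * h).
Proof.
rewrite !whomogP /grading => fd he; rewrite rmorphM /= fd he rmorphM exprD; ring.
Qed.

Lemma whomogC a : whomog 0 a%:MP.
Proof. by rewrite whomogP /grading mmapC mulr1. Qed.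

Lemma whomogX k : whomog (w k) 'X_k.
Proof. by rewrite whomogP /grading mmapX mmap1U. Qed.

Lemma whomogXn d r f : whomog d f -> whomog (r * d) (f ^+ r).
Proof.
move=> fd; elim: r => [|r IHr]; first by rewrite expr0 -mpolyC1; apply: whomogC.
by rewrite exprS mulSn; apply: whomogM.
Qed.

(** The images of the factors by the substitution multiply to a monomial in t,
    so both are monomials. *)
Lemma whomog_factors d (f g h : {mpoly F[n]}) : f != 0 -> whomog d f ->
  f = g * h -> exists i k, [/\ (i + k)%N = d, whomog i g & whomog k h].
Proof.
move=> fN0 /grading_whomog fd fE.
have ghE : grading g * grading h = f%:P * 'X^d by rewrite -fd fE /grading rmorphM.
have [i [k [b [e [ikd gE hE]]]]] := factors_of_monomial fN0 ghE.
by exists i, k; split; [|apply: whomog_of_monomial gE|apply: whomog_of_monomial hE].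
Qed.

(** Restriction to a parametrized curve along which a variable of weight w has
    degree at most w. *)
Lemma size_mmap_whomog (K : idomainType) (iota : {rmorphism F -> {poly K}})
    (v : 'I_n -> {poly K}) d (f : {mpoly F[n]}) :
  (forall a, size (iota a) <= 1)%N -> (forall k, size (v k) <= (w k).+1)%N ->
  whomog d f -> (size (mmap iota v f) <= d.+1)%N.
Proof.
move=> si sv fd; rewrite /mmap big_seq.
have sizeM (p r : {poly K}) a b :
    (size p <= a.+1 -> size r <= b.+1 -> size (p * r)%R <= (a + b).+1)%N.
  move=> pa rb; apply: leq_trans (size_polyMleq _ _) _.
  by have := leq_add pa rb; rewrite addSn addnS; case: (size p + size r)%N.
apply: (big_ind (fun p : {poly K} => (size p <= d.+1)%N)) => [|p r pd rd|m mf].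
- by rewrite size_poly0.
- by apply: leq_trans (size_polyD _ _) _; rewrite geq_max pd.
rewrite -[d]add0n; apply: (sizeM) (si _) _; rewrite -(fd _ mf) /mmap1 /weight.
apply: (big_ind2 (fun (p : {poly K}) a => (size p <= a.+1)%N)) => [|p a r b|k _].
- by rewrite size_poly1.
- exact: sizeM.
elim: (m k) => [|j IHj]; first by rewrite expr0 size_poly1.
by rewrite exprS mulnS; apply: sizeM.
Qed.

(** A polynomial of degree 0 for the weights involves only variables of weight 0. *)
Lemma mmap_whomog0 (S : comNzRingType) (iota : {rmorphism F -> S})
    (v v' : 'I_n -> S) (f : {mpoly F[n]}) :
  whomog 0 f -> (forall k, w k = 0%N -> v k = v' k) ->
  mmap iota v f = mmap iota v' f.
Proof.
move=> f0 vv'; rewrite /mmap big_seq [RHS]big_seq; apply: eq_bigr => m mf.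
congr (_ * _); apply: eq_bigr => k _.
have /eqP := f0 _ mf; rewrite /weight sum_nat_eq0 => /forallP/(_ k).
rewrite muln_eq0 => /orP[/eqP /vv' -> // | /eqP ->]; by rewrite !expr0.
Qed.
End Weights.

(** * The equation as a polynomial *)

Section FormsMorphism.
Variables (R S : comNzRingType) (phi : {rmorphism R -> S}) (q : nat).

Lemma points_form_morph x0 x1 :
  phi (points_form q x0 x1) = points_form q (phi x0) (phi x1).
Proof. by rewrite /points_form rmorphB !rmorphM !rmorphXn. Qed.

Lemma frob_form_morph g c x0 x1 :
  phi (frob_form q g c x0 x1) = frob_form q (phi g) (phi c) (phi x0) (phi x1).
Proof.
by rewrite /frob_form !(rmorphD, rmorphN, rmorphM, rmorphXn, rmorph1).
Qed.

Lemma filling_form_morph g h c x0 x1 y0 y1 :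
  phi (filling_form q g h c x0 x1 y0 y1) = filling_form q (phi g) (phi h) (phi c)
    (phi x0) (phi x1) (phi y0) (phi y1).
Proof.
by rewrite /filling_form rmorphD !rmorphM /= !points_form_morph !frob_form_morph.
Qed.
End FormsMorphism.

Section Poly.
Variables (R : comNzRingType) (q : nat) (g h c : R).

Definition filling_poly : {mpoly R[2 + 2]} :=
  filling_form q g%:MP h%:MP c%:MP
    'X_(lshift 2 0) 'X_(lshift 2 1) 'X_(rshift 2 0) 'X_(rshift 2 1).

Lemma mmap_filling_poly (S : comNzRingType) (phi : {rmorphism R -> S})
    (v : 'I_(2 + 2) -> S) :
  mmap phi v filling_poly = filling_form q (phi g) (phi h) (phi c)
    (v (lshift 2 0)) (v (lshift 2 1)) (v (rshift 2 0)) (v (rshift 2 1)).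
Proof. by rewrite filling_form_morph /= !mmapC !mmapX !mmap1U. Qed.

End Poly.

Lemma map_filling_poly (R S : comNzRingType) (phi : {rmorphism R -> S}) q
    (g h c : R) :
  map_mpoly phi (filling_poly q g h c) = filling_poly q (phi g) (phi h) (phi c).
Proof. by rewrite filling_form_morph /= !map_mpolyC !map_mpolyX. Qed.

Lemma dehomogenize_filling_poly (R : comNzRingType) q (g h c : R) (i j : 'I_2) :
  dehomogenize i j (filling_poly q g h c) = filling_form q g%:MP h%:MP c%:MP
    (chart_subst R i j (lshift 2 0)) (chart_subst R i j (lshift 2 1))
    (chart_subst R i j (rshift 2 0)) (chart_subst R i j (rshift 2 1)).
Proof.
by rewrite /dehomogenize /comp_mpoly mmap_filling_poly !tnth_mktuple.
Qed.

Definition coords (S : Type) (x0 x1 y0 y1 : S) (k : 'I_(2 + 2)) : S :=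
  match split k with
  | inl i => if i == 0 then x0 else x1
  | inr j => if j == 0 then y0 else y1
  end.

Lemma coords_lshift (S : Type) (x0 x1 y0 y1 : S) i :
  coords x0 x1 y0 y1 (lshift 2 i) = if i == 0 then x0 else x1.
Proof. by rewrite /coords (unsplitK (inl i)). Qed.

Lemma coords_rshift (S : Type) (x0 x1 y0 y1 : S) j :
  coords x0 x1 y0 y1 (rshift 2 j) = if j == 0 then y0 else y1.
Proof. by rewrite /coords (unsplitK (inr j)). Qed.

Definition coordsE := (coords_lshift, coords_rshift).

Definition xweight := coords 1%N 1%N 0%N 0%N.
Definition yweight := coords 0%N 0%N 1%N 1%N.

Lemma bihomogeneous_whomog (F : fieldType) (a b : nat) (f : {mpoly F[2 + 2]}) :
  whomog xweight a f -> whomog yweight b f -> bihomogeneous a b f.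
Proof.
move=> fa fb m mf; rewrite -(fa _ mf) -(fb _ mf) /weight !big_split_ord /=; split.
  rewrite [X in _ = (_ + X)%N]big1 ?addn0 => [|k _]; last first.
    by rewrite /xweight coordsE if_same.
  by apply: eq_bigr => k _; rewrite /xweight coordsE if_same mul1n.
rewrite [X in _ = (X + _)%N]big1 ?add0n => [|k _]; last first.
  by rewrite /yweight coordsE if_same.
by apply: eq_bigr => k _; rewrite /yweight coordsE if_same mul1n.
Qed.

Lemma whomog_filling_poly (F : fieldType) q (g h c : F) w a b :
  w (lshift 2 0) = a -> w (lshift 2 1) = a ->
  w (rshift 2 0) = b -> w (rshift 2 1) = b ->
  whomog w ((q * a + a) + (q * b + b)) (filling_poly q g h c).
Proof.
move=> w0 w1 w2 w3.
have x0 := @whomogX F _ w (lshift 2 0); have x1 := @whomogX F _ w (lshift 2 1).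
have y0 := @whomogX F _ w (rshift 2 0); have y1 := @whomogX F _ w (rshift 2 1).
rewrite w0 w1 w2 w3 in x0 x1 y0 y1.
have pointsh e (u v : {mpoly F[2 + 2]}) : whomog w e u -> whomog w e v ->
    whomog w (q * e + e) (points_form q u v).
  by move=> ue ve; apply: whomogB; apply: whomogM => //; apply: whomogXn.
have frobh e k (u v : {mpoly F[2 + 2]}) : whomog w e u -> whomog w e v ->
    whomog w (q * e + e) (frob_form q k%:MP c%:MP u v).
  have scale d a' (s : {mpoly F[2 + 2]}) : whomog w d s -> whomog w d (a'%:MP * s).
    by move=> sd; have := whomogM (@whomogC _ _ w a') sd; rewrite add0n.
  move=> ue ve; rewrite /frob_form -mpolyC1 -mpolyCD.
  by apply: whomogB; [apply: whomogD; [apply: whomogB|] |];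
    do ?apply: scale; apply: whomogM => //; exact: whomogXn.
rewrite /filling_poly /filling_form; apply: whomogD; apply: whomogM.
- exact: pointsh.
- exact: frobh.
- exact: frobh.
exact: pointsh.
Qed.

(** * Nonsingularity *)

(** The partial derivatives of the equation, for an arbitrary derivation that
    kills q-th powers and the coefficients, followed by evaluation; in the
    charts the derivation is applied to polynomials in the chart coordinates. *)
Lemma derivation_filling_form (R S : comNzRingType) (phi : {rmorphism R -> S})
    q (D : R -> R) (g h c x0 x1 y0 y1 : R) :
  {morph D : u v / u + v} -> {morph D : u / - u} ->
  (forall u v, D (u * v) = D u * v + u * D v) -> (forall u, D (u ^+ q) = 0) ->
  D 1 = 0 -> D g = 0 -> D h = 0 -> D c = 0 ->
  forall G H C X0 X1 Y0 Y1 : S,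
  phi g = G -> phi h = H -> phi c = C ->
  phi x0 = X0 -> phi x1 = X1 -> phi y0 = Y0 -> phi y1 = Y1 ->
  let L := @points_form S q in let A k := frob_form q k C in
  phi (D (filling_form q g h c x0 x1 y0 y1)) =
    phi (D x0) * (L Y0 Y1 * (X0 ^+ q + G * X1 ^+ q) - A H Y0 Y1 * X1 ^+ q)
  - phi (D x1) * (L Y0 Y1 * ((1 + G) * X0 ^+ q + C * X1 ^+ q) - A H Y0 Y1 * X0 ^+ q)
  + phi (D y0) * (L X0 X1 * (Y0 ^+ q + H * Y1 ^+ q) - A G X0 X1 * Y1 ^+ q)
  - phi (D y1) * (L X0 X1 * ((1 + H) * Y0 ^+ q + C * Y1 ^+ q) - A G X0 X1 * Y0 ^+ q).
Proof.
move=> DD DN DM Dq D1 Dg Dh Dc G H C X0 X1 Y0 Y1 <- <- <- <- <- <- <- /=.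
rewrite /filling_form /points_form /frob_form.
rewrite !(DD, DN, DM, Dq, D1, Dg, Dh, Dc).
by rewrite !(rmorphD, rmorphN, rmorphM, rmorphXn, rmorph0, rmorph1); ring.
Qed.

Section Singular.
Variables (K : fieldType) (q : nat).
Hypotheses (char_q : [pchar K].-nat q) (q_gt1 : (1 < q)%N).

Lemma mderiv_frob n (l : 'I_n) (u : {mpoly K[n]}) : mderiv l (u ^+ q) = 0.
Proof.
have mderivXn r : mderiv l (u ^+ r) = (r%:R * mderiv l u) * u ^+ r.-1.
  elim: r => [|r IHr]; first by rewrite expr0 -mpolyC1 mderivC !mul0r.
  rewrite exprS mderivM IHr /= -natr1; case: r {IHr} => [|r] /=; first ring.
  by rewrite exprS; ring.
have q0 : q%:R = 0 :> {mpoly K[n]}.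
  have [p pr_p p_q] := pdivP q_gt1.
  have /(pnatPpi char_q) pK : p \in \pi(q).
    by rewrite mem_primes pr_p p_q ltnW.
  have [r ->] := dvdnP p_q.
  by rewrite natrM -[p%:R]mpolyC_nat (pcharf0 pK) mpolyC0 mulr0.
by rewrite mderivXn q0 !mul0r.
Qed.

Lemma mderiv_filling_form n (l : 'I_n) (p : 'I_n -> K) (g h c : K)
    (x0 x1 y0 y1 : {mpoly K[n]}) (X0 X1 Y0 Y1 : K) :
  x0.@[p] = X0 -> x1.@[p] = X1 -> y0.@[p] = Y0 -> y1.@[p] = Y1 ->
  let L := @points_form K q in let A k := frob_form q k c in
  (mderiv l (filling_form q g%:MP h%:MP c%:MP x0 x1 y0 y1)).@[p] =
    (mderiv l x0).@[p] * (L Y0 Y1 * (X0 ^+ q + g * X1 ^+ q) - A h Y0 Y1 * X1 ^+ q)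
  - (mderiv l x1).@[p] * (L Y0 Y1 * ((1 + g) * X0 ^+ q + c * X1 ^+ q)
                          - A h Y0 Y1 * X0 ^+ q)
  + (mderiv l y0).@[p] * (L X0 X1 * (Y0 ^+ q + h * Y1 ^+ q) - A g X0 X1 * Y1 ^+ q)
  - (mderiv l y1).@[p] * (L X0 X1 * ((1 + h) * Y0 ^+ q + c * Y1 ^+ q)
                          - A g X0 X1 * Y0 ^+ q).
Proof.
apply: (derivation_filling_form (phi := meval p) (D := mderiv l)).
- exact: mderivD.
- exact: mderivN.
- exact: mderivM.
- exact: mderiv_frob.
- by rewrite -mpolyC1 mderivC.
1-3: exact: mderivC.
all: exact: mevalC.
Qed.

(** A chart gives only the derivative in the coordinate other than the i-th, the
    latter being set to 1; Euler's relation recovers the missing one. Here the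
    two derivatives are d0 and - d1. *)
Lemma chart_euler (i : 'I_2) (x : 'I_2 -> K) (d0 d1 : K) : x i = 1 ->
  x 0 * d0 - x 1 * d1 = 0 -> (0 != i)%:R * d0 - (1 != i)%:R * d1 = 0 ->
  d0 = 0 /\ d1 = 0.
Proof.
case: i => [[|[|//]] lt_i] /=.
  have -> : Ordinal lt_i = 0 by apply: val_inj.
  move=> -> e /eqP; rewrite mul0r mul1r sub0r oppr_eq0 => /eqP d1E.
  by move: e; rewrite d1E mul1r mulr0 subr0.
have -> : Ordinal lt_i = 1 by apply: val_inj.
move=> -> e; rewrite mul0r mul1r subr0 => d0E.
by move: e; rewrite d0E mul1r mulr0 sub0r => /eqP; rewrite oppr_eq0 => /eqP.
Qed.

End Singular.

Lemma ord2_ind (P : 'I_2 -> Prop) : P 0 -> P 1 -> forall i, P i.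
Proof.
move=> P0 P1 [[|[|//]] lt_i].
  by have -> : Ordinal lt_i = 0 by apply: val_inj.
by have -> : Ordinal lt_i = 1 by apply: val_inj.
Qed.

Section Smooth.
Variables (K : fieldType) (q : nat).
Hypotheses (char_q : [pchar K].-nat q) (q_gt1 : (1 < q)%N).
Variables (g h c : K).
Hypotheses (gq : g ^+ q = g) (hq : h ^+ q = h) (cq : c ^+ q = c).
Hypotheses (ghN0 : g + h != 0) (ghN1 : g + h != -1).
Hypothesis noroot : forall x : K, x ^+ q = x -> x ^+ 2 - x - c != 0.

Lemma filling_poly_smooth i j (p : 'I_2 -> K) :
  ~ affine_singular_point (dehomogenize i j (filling_poly q g h c)) p.
Proof.
rewrite dehomogenize_filling_poly => -[on_f sing].
pose x k := (chart_subst K i j (lshift 2 k)).@[p].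
pose y k := (chart_subst K i j (rshift 2 k)).@[p].
have csl k : chart_subst K i j (lshift 2 k) = if k == i then 1 else 'X_0.
  by rewrite /chart_subst (unsplitK (inl k)).
have csr k : chart_subst K i j (rshift 2 k) = if k == j then 1 else 'X_1.
  by rewrite /chart_subst (unsplitK (inr k)).
have d1 l : mderiv l 1 = 0 :> {mpoly K[2]} by rewrite -mpolyC1 mderivC.
have dX l k : mderiv l 'X_k = (k == l)%:R :> {mpoly K[2]}.
  rewrite mderivX mnm1E; case: eqVneq => [->|_]; last by rewrite scale0r.
  by rewrite -{1}[U_(l)%MM]add0m addmK mpolyX0 scale1r.
have dl l k : mderiv l (chart_subst K i j (lshift 2 k))
    = ((l == 0) && (k != i))%:R :> {mpoly K[2]}.
  by rewrite csl; case: eqP => _; rewrite ?d1 ?andbF // dX andbT eq_sym.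
have dr l k : mderiv l (chart_subst K i j (rshift 2 k))
    = ((l == 1) && (k != j))%:R :> {mpoly K[2]}.
  by rewrite csr; case: eqP => _; rewrite ?d1 ?andbF // dX andbT eq_sym.
have xi : x i = 1 by rewrite /x csl eqxx meval1.
have yj : y j = 1 by rewrite /y csr eqxx meval1.
have coord_neq0 (z : 'I_2 -> K) k : z k = 1 -> (z 0, z 1) != (0, 0).
  move=> zk; apply/eqP => -[z0 z1]; have := oner_neq0 K.
  by rewrite -zk; elim/ord2_ind: k {zk}; rewrite ?z0 ?z1 eqxx.
pose L := @points_form K q; pose A k := frob_form q k c.
pose P0 := L (y 0) (y 1) * (x 0 ^+ q + g * x 1 ^+ q) - A h (y 0) (y 1) * x 1 ^+ q.
pose P1 := L (y 0) (y 1) * ((1 + g) * x 0 ^+ q + c * x 1 ^+ q)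
           - A h (y 0) (y 1) * x 0 ^+ q.
pose Q0 := L (x 0) (x 1) * (y 0 ^+ q + h * y 1 ^+ q) - A g (x 0) (x 1) * y 1 ^+ q.
pose Q1 := L (x 0) (x 1) * ((1 + h) * y 0 ^+ q + c * y 1 ^+ q)
           - A g (x 0) (x 1) * y 0 ^+ q.
have grad l : ((l == 0 :> 'I_2) && (0 != i))%:R * P0
    - ((l == 0 :> 'I_2) && (1 != i))%:R * P1
    + ((l == 1 :> 'I_2) && (0 != j))%:R * Q0 - ((l == 1 :> 'I_2) && (1 != j))%:R * Q1 = 0.
  have := sing l.
  rewrite (mderiv_filling_form char_q q_gt1 l g h c (X0 := x 0) (X1 := x 1)
    (Y0 := y 0) (Y1 := y 1)) // !dl !dr.
  by rewrite !rmorph_nat.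
have F0 : filling_form q g h c (x 0) (x 1) (y 0) (y 1) = 0.
  by rewrite -on_f filling_form_morph /= !mevalC.
have eulerX : x 0 * P0 - x 1 * P1 = 0.
  by rewrite -F0 /P0 /P1 /filling_form /L /A /points_form /frob_form; ring.
have eulerY : y 0 * Q0 - y 1 * Q1 = 0.
  by rewrite -F0 /Q0 /Q1 /filling_form /L /A /points_form /frob_form; ring.
have gradX : (0 != i)%:R * P0 - (1 != i)%:R * P1 = 0.
  by have := grad 0; rewrite eqxx /= !mul0r addr0 subr0.
have gradY : (0 != j)%:R * Q0 - (1 != j)%:R * Q1 = 0.
  by have := grad 1; rewrite eqxx /= !mul0r subr0 add0r.
have [P0E P1E] := chart_euler xi eulerX gradX.
have [Q0E Q1E] := chart_euler yj eulerY gradY.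
by apply: (filling_form_smooth char_q cq noroot gq hq ghN0 ghN1
  (coord_neq0 x i xi) (coord_neq0 y j yj)); apply/eqP; rewrite -subr_eq0; apply/eqP.
Qed.
End Smooth.

(** * Irreducibility *)

Lemma mmap_morph n (R : nzRingType) (S T : comNzRingType) (phi : {rmorphism S -> T})
    (iota : {rmorphism R -> S}) (v : 'I_n -> S) (f : {mpoly R[n]}) :
  phi (mmap iota v f) = mmap (phi \o iota) (phi \o v) f.
Proof.
rewrite /mmap rmorph_sum; apply: eq_bigr => m _; rewrite rmorphM; congr (_ * _).
by rewrite /mmap1 rmorph_prod; apply: eq_bigr => k _; rewrite rmorphXn.
Qed.

Lemma eq_mmap n (R : nzRingType) (S : comNzRingType) (iota iota' : R -> S)
    (v v' : 'I_n -> S) (f : {mpoly R[n]}) :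
  iota =1 iota' -> v =1 v' -> mmap iota v f = mmap iota' v' f.
Proof.
move=> ii vv; rewrite /mmap; apply: eq_bigr => m _; rewrite ii; congr (_ * _).
exact: mmap1_eq.
Qed.

(** A deficit in the degree of p cannot be made up by r. *)
Lemma size_factor_max (R : nzRingType) (p r : {poly R}) i k :
  (size p <= i.+1 -> size r <= k.+1 -> (i + k).+1 <= size (p * r)%R -> size p = i.+1)%N.
Proof.
move=> pi rk le_pr; apply/eqP; rewrite eqn_leq pi /= ltnNge; apply/negP => {}pi.
have := leq_trans le_pr (size_polyMleq p r); rewrite leqNgt ltnS => /negP; apply.
have := leq_add pi rk; rewrite addnS.
by case: (size p + size r)%N.
Qed.

Section Closed.
Variables (K : closedFieldType) (q : nat).
Hypotheses (char_q : [pchar K].-nat q) (q_gt1 : (1 < q)%N).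
Variable c : K.
Hypothesis cq : c ^+ q = c.
Hypothesis noroot : forall x : K, x ^+ q = x -> x ^+ 2 - x - c != 0.

Lemma ramification_point : exists x : K, x ^+ 2 - x - c = 0.
Proof.
have [x xE] := @solve_monicpoly K 2 (fun i => if i == 0%N then c else 1) isT.
exists x; rewrite xE big_ord_recl big_ord1 /= expr0 expr1; ring.
Qed.

(** In an algebraically closed field the two forms take any prescribed ratio e:
    the difference is monic of degree q + 1 in y. *)
Lemma frob_form_value (h e : K) : exists y : K,
  frob_form q h c y 1 = e * points_form q y 1.
Proof.
have [r qE] : exists r, q = r.+2 by case: q q_gt1 => [|[|r]] // _; exists r.
(* a lists the coefficients of the right-hand side of the monic equation
   y ^+ q.+1 = (1 + h + e) * y ^+ q - (h + e) * y + c. *)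
pose a i := if i == 0%N then c else if i == 1%N then - (h + e) else
  if i == q then 1 + h + e else 0.
have [y yE] := @solve_monicpoly K q.+1 a isT.
exists y; apply/eqP; rewrite -subr_eq0 /frob_form /points_form !expr1n -exprSr yE.
have -> : \sum_(i < q.+1) a i * y ^+ i = c - (h + e) * y + (1 + h + e) * y ^+ q.
  rewrite qE big_ord_recl big_ord_recr big_ord_recl /=.
  rewrite big1 => [|i _]; last first.
    by rewrite /a qE /bump /= !add1n /= !eqSS ltn_eqF ?mul0r.
  by rewrite /a qE /bump /= !add1n eqxx expr0 expr1; ring.
apply/eqP; ring.
Qed.

(** With x^q = 1 - x and c = x^2 - x, the equation of the fibre is the value of
    U at y times ('X^q - x^q) ('X - x), where the first factor is ('X - x)^q. *)
Lemma ramified_fibre (g h x y : K) : x ^+ 2 - x - c = 0 ->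
  frob_form q h c y 1 = (x ^+ q + g) * points_form q y 1 ->
  filling_form q g%:P h%:P c%:P 'X 1 y%:P 1
    = (points_form q y 1)%:P * ('X - x%:P) ^+ q.+1.
Proof.
move=> Qx Ay; have xq := frob_root char_q cq noroot Qx.
have charP : [pchar {poly K}].-nat q by rewrite (eq_pnat _ (pchar_lalg _)).
have cE : c = x ^+ 2 - x by rewrite -[LHS]add0r -Qx; ring.
have -> : filling_form q g%:P h%:P c%:P 'X 1 y%:P 1 =
    (points_form q y 1)%:P *
      (points_form q 'X 1 * (x ^+ q + g)%:P + frob_form q g%:P c%:P 'X 1).
  have Ay' : frob_form q h%:P c%:P y%:P 1 = ((x ^+ q + g) * points_form q y 1)%:P.
    by rewrite -Ay frob_form_morph /= polyC1.
  have Ly : points_form q y%:P 1 = (points_form q y 1)%:P.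
    by rewrite points_form_morph /= polyC1.
  by rewrite /filling_form Ay' Ly polyCM; ring.
congr (_ * _); rewrite (exprSr ('X - _)) (frobB charP) -rmorphXn /= xq.
rewrite /points_form /frob_form !expr1n cE.
rewrite !(polyCD, polyCN, polyC1) expr2 polyCM; ring.
Qed.

End Closed.

Lemma dehomogenizeM (R : comNzRingType) i j (f g : {mpoly R[2 + 2]}) :
  dehomogenize i j (f * g) = dehomogenize i j f * dehomogenize i j g.
Proof. exact: rmorphM. Qed.

Lemma singular_product (K : fieldType) (f g : {mpoly K[2]}) (p : 'I_2 -> K) :
  f.@[p] = 0 -> g.@[p] = 0 -> affine_singular_point (f * g) p.
Proof.
move=> f0 g0; split=> [|l]; first by rewrite mevalM f0 mul0r.
by rewrite mderivM mevalD !mevalM f0 g0 mul0r mulr0 addr0.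
Qed.

Lemma whomog0_unit (F : fieldType) (f : {mpoly F[2 + 2]}) : f != 0 ->
  whomog xweight 0 f -> whomog yweight 0 f -> f \is a GRing.unit.
Proof.
move=> fN0 fx fy; have fE : f = (f@_0%MM)%:MP.
  apply/mpolyP => m; rewrite mcoeffC eq_sym.
  have [-> | mN0] := eqVneq m 0%MM; first by rewrite mulr1.
  rewrite mulr0; apply: memN_msupp_eq0; apply: contra mN0 => mf; apply/eqP.
  have := fx _ mf; have := fy _ mf; rewrite /weight.
  move=> /eqP; rewrite sum_nat_eq0 => /forallP wy.
  move=> /eqP; rewrite sum_nat_eq0 => /forallP wx.
  apply/mnmP => k; rewrite mnm0E; apply/eqP.
  move: (wx k) (wy k); rewrite !muln_eq0 /xweight /yweight /coords.
  by case: (split k) => e; rewrite !if_same /=; [move=> -> | move=> _ ->].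
rewrite fE; apply: rmorph_unit; rewrite unitfE.
by apply: contraNneq fN0 => f0; rewrite fE f0 mpolyC0.
Qed.

Section Irreducible.
Variables (F : fieldType) (K : closedFieldType) (iota : {rmorphism F -> K}).
Variables (q : nat).
Hypotheses (char_q : [pchar K].-nat q) (q_gt1 : (1 < q)%N).
Variables (g h c : F).
Local Notation g' := (iota g).
Local Notation h' := (iota h).
Local Notation c' := (iota c).
Hypotheses (gq : g' ^+ q = g') (hq : h' ^+ q = h') (cq : c' ^+ q = c').
Hypotheses (ghN0 : g' + h' != 0) (ghN1 : g' + h' != -1).
Hypothesis noroot : forall x : K, x ^+ q = x -> x ^+ 2 - x - c' != 0.
Local Notation f := (filling_poly q g h c).

Let on_line (v : 'I_(2 + 2) -> {poly K}) (r : {mpoly F[2 + 2]}) : {poly K} :=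
  mmap (polyC \o iota) v r.

Let at_point (v : 'I_(2 + 2) -> K) (r : {mpoly F[2 + 2]}) : K := mmap iota v r.

Let on_lineM v r s : on_line v (r * s) = on_line v r * on_line v s.
Proof. exact: rmorphM. Qed.

Let at_pointM v r s : at_point v (r * s) = at_point v r * at_point v s.
Proof. exact: rmorphM. Qed.

Let on_line_filling x0 x1 y0 y1 : on_line (coords x0 x1 y0 y1) f
  = filling_form q g'%:P h'%:P c'%:P x0 x1 y0 y1.
Proof. by rewrite /on_line mmap_filling_poly !coordsE. Qed.

Let at_point_filling x0 x1 y0 y1 : at_point (coords x0 x1 y0 y1) f
  = filling_form q g' h' c' x0 x1 y0 y1.
Proof. by rewrite /at_point mmap_filling_poly !coordsE. Qed.

Let horner_on_line v r t :
  (on_line v r).[t] = at_point (fun k => (v k).[t]) r.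
Proof.
rewrite -/(horner_eval t _) /on_line mmap_morph; apply: eq_mmap => // a /=.
by rewrite /horner_eval hornerC.
Qed.

Let at_point_chart (p : 'I_2 -> K) r :
  (dehomogenize 1 1 (map_mpoly iota r)).@[p]
    = at_point (coords (p 0) 1 (p 1) 1) r.
Proof.
rewrite /dehomogenize /map_mpoly /comp_mpoly !mmap_morph; apply: eq_mmap => [a|k].
  by rewrite /= mmapC /= mevalC.
rewrite [LHS]mmapX mmap1U /= tnth_mktuple /chart_subst /coords.
by case: (split k) => e; elim/ord2_ind: e; rewrite /= ?mevalXU ?meval1.
Qed.

(** A common zero of two factors of f would be a singular point. *)
Lemma smooth_factor_neq0 r s x y : f = r * s ->
  at_point (coords x 1 y 1) r = 0 -> at_point (coords x 1 y 1) s = 0 -> False.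
Proof.
move=> fE r0 s0; pose p (k : 'I_2) := if k == 0 then x else y.
apply: (filling_poly_smooth char_q q_gt1 gq hq cq ghN0 ghN1 noroot
  (i := 1) (j := 1) (p := p)).
rewrite -map_filling_poly fE rmorphM dehomogenizeM.
by apply: singular_product; rewrite at_point_chart.
Qed.

(** Restricted to the totally ramified fibre, factors of positive degree in the
    first pair of variables both acquire the root x. *)
Lemma factor_xweight i k r s : f = r * s -> (i + k)%N = q.+1 ->
  whomog xweight i r -> whomog xweight k s -> i = 0%N \/ k = 0%N.
Proof.
move=> fE ikq ri sk.
have [x Qx] := ramification_point c'.
have [y Ay] := frob_form_value q_gt1 c' h' (x ^+ q + g').
have VN0 : points_form q y 1 != 0.
  apply/eqP=> V0; move: Ay; rewrite V0 mulr0 => A0.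
  by have [_ /eqP] := points_frob_form_coprime char_q noroot V0 A0; rewrite oner_eq0.
pose v := coords 'X 1 y%:P (1 : {poly K}).
have rsE : on_line v r * on_line v s = (points_form q y 1)%:P * ('X - x%:P) ^+ q.+1.
  by rewrite -on_lineM -fE on_line_filling (ramified_fibre char_q cq noroot Qx Ay).
have szv k' : (size (v k') <= (xweight k').+1)%N.
  rewrite /v /xweight /coords; case: (split k') => e; elim/ord2_ind: e => /=;
    by rewrite ?size_polyX ?size_poly1 ?size_polyC_leq1.
have szC a : (size ((polyC \o iota) a) <= 1)%N by rewrite /= size_polyC_leq1.
have szr := size_mmap_whomog szC szv ri.
have szs := size_mmap_whomog szC szv sk.
have szrs : ((i + k).+1 <= size (on_line v r * on_line v s)%R)%N.
  by rewrite rsE mul_polyC size_scale // size_exp_XsubC ikq.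
have szrE := size_factor_max szr szs szrs.
rewrite mulrC addnC in szrs; have szsE := size_factor_max szs szr szrs.
have root_x (u u' : {poly K}) d : size u = d.+2 ->
    u * u' = (points_form q y 1)%:P * ('X - x%:P) ^+ q.+1 -> u.[x] = 0.
  move=> uE uu'; have /closed_rootP[t ut] : size u != 1%N by rewrite uE.
  suff -> : x = t by apply/eqP.
  have := congr1 (fun p : {poly K} => p.[t]) uu'.
  rewrite !hornerE (eqP ut) mul0r => /esym/eqP.
  by rewrite mulf_eq0 (negPf VN0) expf_eq0 subr_eq0 /= => /eqP.
case: i ri ikq szr szrE {szs szrs} => [|i] ri ikq szr szrE; first by left.
case: k sk ikq szsE => [|k] sk ikq szsE; first by right.
have r0 := root_x _ _ _ szrE rsE.
rewrite mulrC in rsE; have s0 := root_x _ _ _ szsE rsE.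
have vx k' : (v k').[x] = coords x 1 y 1 k'.
  by rewrite /v /coords; case: (split k') => e; case: eqP => _; rewrite !hornerE.
rewrite horner_on_line in r0; rewrite horner_on_line in s0.
case: (@smooth_factor_neq0 r s x y) => //; [rewrite -r0|rewrite -s0];
  by apply: eq_mmap => // k'; rewrite vx.
Qed.

(** If r has positive degree in the second pair of variables, it has a zero t on
    the line X = x, with x a root of the quadratic polynomial: no degree is lost
    there, because the restriction of f to that line has leading coefficient
    U(x) != 0. Then f vanishes at (X, t) for every X; the points X = (1 : 0) and
    X = x give a common zero of the two forms at t. *)
Lemma constant_factor r s : f = r * s -> f != 0 -> whomog xweight 0 r ->
  r \is a GRing.unit.
Proof.
move=> fE fN0 r0.
have rN0 : r != 0 by apply: contraNneq fN0 => rE; rewrite fE rE mul0r.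
have fy : whomog yweight (q * 0 + 0 + (q * 1 + 1)) f.
  by apply: whomog_filling_poly; rewrite /yweight coordsE.
have [j [l [jl rj sl]]] := whomog_factors fN0 fy fE.
suff j0 : j = 0%N by rewrite j0 in rj; apply: whomog0_unit.
case: j jl rj => // j jl rj.
have [x Qx] := ramification_point c'.
have xq := frob_root char_q cq noroot Qx.
have UN0 : points_form q x 1 != 0.
  rewrite /points_form mulr1 expr1n mul1r subr_eq0.
  by apply: contraPneq Qx => /noroot /eqP.
have q_gt0 : (q == 0%N) = false by case: q q_gt1.
pose v := coords x%:P 1 'X (1 : {poly K}).
have szv k' : (size (v k') <= (yweight k').+1)%N.
  rewrite /v /yweight /coords; case: (split k') => e; elim/ord2_ind: e => /=;
    by rewrite ?size_polyX ?size_poly1 ?size_polyC_leq1.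
have szC a : (size ((polyC \o iota) a) <= 1)%N by rewrite /= size_polyC_leq1.
have szr := size_mmap_whomog szC szv rj.
have szs := size_mmap_whomog szC szv sl.
have szrs : ((j.+1 + l).+1 <= size (on_line v r * on_line v s)%R)%N.
  rewrite ltnNge; apply/negP => /(nth_default 0) top0.
  suff : (on_line v f)`_(j.+1 + l) = points_form q x 1.
    by rewrite fE on_lineM top0 => /esym/eqP; rewrite (negPf UN0).
  have -> : on_line v f = (points_form q x 1)%:P * 'X^(q.+1)
      + (frob_form q g' c' x 1 - points_form q x 1 * (1 + h'))%:P * 'X^q
      + (points_form q x 1 * h' - frob_form q g' c' x 1)%:P * 'X
      - (points_form q x 1 * c')%:P.
    have Ax : frob_form q g'%:P c'%:P x%:P 1 = (frob_form q g' c' x 1)%:P.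
      by rewrite frob_form_morph /= polyC1.
    have Lx : points_form q x%:P 1 = (points_form q x 1)%:P.
      by rewrite points_form_morph /= polyC1.
    rewrite on_line_filling /filling_form Ax Lx.
    move: (frob_form q g' c' x 1) (points_form q x 1) => A L.
    rewrite /points_form /frob_form !expr1n !(polyCM, polyCD, polyCN, polyC1) exprSr.
    ring.
  rewrite jl muln0 muln1 add0n addn1.
  rewrite !(coefD, coefN, coefCM, coefXn, coefX, coefC) eqxx !eqSS.
  by rewrite (gtn_eqF (ltnSn q)) q_gt0 !(mulr0, mulr1, addr0, subr0).
have szrE := size_factor_max szr szs szrs.
have /closed_rootP[t rt] : size (on_line v r) != 1%N by rewrite szrE.
have rx : at_point (coords x 1 t 1) r = 0.
  rewrite -(eqP rt) horner_on_line; apply: eq_mmap => // k'.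
  by rewrite /v /coords; case: (split k') => e; case: eqP => _; rewrite !hornerE.
have rinf : at_point (coords 1 0 t 1) r = 0.
  rewrite -rx; apply: mmap_whomog0 r0 _ => k'.
  by rewrite /xweight /coords; case: (split k') => e; case: eqP.
have V0 : points_form q t 1 = 0.
  have := at_point_filling 1 0 t 1; rewrite fE at_pointM rinf mul0r.
  rewrite /filling_form {1}/points_form {2}/frob_form !expr1n expr0n q_gt0.
  by rewrite !(mulr0n, oppr0, mulr0, mul0r, mul1r, subr0, addr0, add0r) => <-.
have A0 : frob_form q h' c' t 1 = 0.
  have := at_point_filling x 1 t 1; rewrite fE at_pointM rx mul0r.
  rewrite /filling_form V0 mulr0 addr0 => /esym/eqP.
  by rewrite mulf_eq0 (negPf UN0) => /eqP.
have [_ /eqP] := points_frob_form_coprime char_q noroot V0 A0.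
by rewrite oner_eq0.
Qed.

Lemma filling_poly_neq0 : f != 0.
Proof.
have [x Qx] := ramification_point c'.
have q_gt0 : (q == 0%N) = false by case: q q_gt1.
apply/eqP=> f0; have := at_point_filling 1 0 x 1.
rewrite f0 /at_point rmorph0 /filling_form {1}/points_form {2}/frob_form.
rewrite !expr1n expr0n q_gt0 !(mulr0n, oppr0, mulr0, mul0r, mul1r, subr0, addr0, add0r).
move/esym/eqP; rewrite /points_form mulr1 expr1n mul1r subr_eq0 => /eqP /noroot.
by rewrite Qx eqxx.
Qed.

Lemma filling_poly_irreducible : irreducible_elt f.
Proof.
have fN0 := filling_poly_neq0.
split=> [|r s fE].
  apply/negP => /(rmorph_unit (mmap iota (coords 0 0 0 0))).
  rewrite -[X in X \is a _]/(at_point _ _) at_point_filling /filling_form /points_form.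
  by rewrite !mulr0 subrr !(mul0r, mulr0) addr0 unitr0.
have fx : whomog xweight (q * 1 + 1 + (q * 0 + 0)) f.
  by apply: whomog_filling_poly; rewrite /xweight coordsE.
have [i [k [ik ri sk]]] := whomog_factors fN0 fx fE.
have ikq : (i + k)%N = q.+1 by rewrite ik muln1 muln0 !addn0 addn1.
have [i0 | k0] := factor_xweight fE ikq ri sk.
  by rewrite i0 in ri; left; apply: constant_factor fE fN0 ri.
by rewrite k0 in sk; rewrite mulrC in fE; right; apply: constant_factor fE fN0 sk.
Qed.

End Irreducible.

(** * Finite fields *)

Section FiniteField.
Variable F : finFieldType.

Lemma card_pchar_nat : [pchar F].-nat #|F|.
Proof.
have /is_abelemP[p pr_p /abelem_pgroup] := finField_is_abelem F.
rewrite /pgroup cardsT => pF; have [n Fn] := p_natP pF.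
by rewrite (eq_pnat _ (pcharf_eq (card_finPcharP Fn pr_p))).
Qed.

(** The map x |-> x^2 - x takes the value 0 at both 0 and 1, so it is not
    injective, hence not surjective. *)
Lemma exists_rootless_quadratic : exists c : F, forall x, x ^+ 2 - x - c != 0.
Proof.
pose s (x : F) := x ^+ 2 - x.
have [/injectiveP s_inj | s_ninj] := boolP (injectiveb s).
  have : (1 : F) = 0 by apply: s_inj; rewrite /s expr1n expr0n subrr subr0.
  by move/eqP; rewrite oner_eq0.
have /existsP[c cs] : [exists c, c \notin codom s].
  apply: contraR s_ninj => /existsPn s_onto.
  suff /image_injP s_inj : #|image s F| == #|F| by apply/injectiveP; apply: in2T.
  by apply/eqP/eq_card => c; have := s_onto c; rewrite negbK => ->.
exists c => x; rewrite subr_eq0; apply: contraNneq cs => <-; exact: codom_f.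
Qed.

Lemma exists_avoiding_two (a b : F) : (2 < #|F|)%N -> exists g : F, g != a /\ g != b.
Proof.
move=> F_gt2; have /subsetPn[g _] : ~~ (F \subset [set a; b]).
  apply/negP => /subset_leq_card; rewrite leqNgt => /negP; apply.
  by apply: leq_ltn_trans F_gt2; rewrite cards2; case: (a != b).
by rewrite !inE negb_or => /andP[ga gb]; exists g.
Qed.

(** The polynomial 'X^q - 'X splits over F with all the elements of F as roots. *)
Lemma frob_fixed_in_image (K : fieldType) (iota : {rmorphism F -> K}) (x : K) :
  x ^+ #|F| = x -> exists a, x = iota a.
Proof.
move=> xq; have : (map_poly iota ('X^#|F| - 'X)).[x] = 0.
  by rewrite rmorphB /= map_polyXn map_polyX !hornerE xq subrr.
rewrite finField_genPoly rmorph_prod horner_prod => /eqP.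
rewrite prodf_seq_eq0 => /hasP[a _ /=].
by rewrite map_polyXsubC !hornerE subr_eq0 => /eqP; exists a.
Qed.

Lemma frob_iota (K : fieldType) (iota : {rmorphism F -> K}) (a : F) :
  iota a ^+ #|F| = iota a.
Proof. by rewrite -rmorphXn expf_card. Qed.

Lemma filling_filling_poly (g h c : F) : filling (filling_poly #|F| g h c).
Proof.
move=> x y _ _; rewrite /on_curve /meval mmap_filling_poly /filling_form.
by rewrite /points_form !expf_card ![_ * row_mx _ _ _ (lshift 2 0)]mulrC
  ![_ * row_mx _ _ _ (rshift 2 0)]mulrC !subrr mul0r mulr0 addr0.
Qed.
End FiniteField.

End FillingCurve.

Theorem theorem3p3 (q : nat) (F : finFieldType) (hF : #|F| = q) (hq : q <> 2) :
  exists f : {mpoly F[2 + 2]},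
    curve_of_bidegree (q + 1) (q + 1) f /\
    nonsingular f /\ irreducible_elt f /\ filling f.
Proof.
subst q.
have q_gt1 := finNzRing_gt1 F.
have q_gt2 : 2 < #|F| by rewrite ltn_neqAle q_gt1 andbT eq_sym; apply/eqP.
have [c c_rootless] := exists_rootless_quadratic F.
have [g [gN0 gN1]] := @exists_avoiding_two F 0%R (-1)%R q_gt2.
have char_K (K : fieldType) (iota : {rmorphism F -> K}) : ([pchar K].-nat #|F|)%R.
  by rewrite (eq_pnat _ (GRing.fmorph_pchar iota)) card_pchar_nat.
have ghN0 (K : fieldType) (iota : {rmorphism F -> K}) :
    (iota g + iota 0 != 0)%R.
  by rewrite -GRing.rmorphD GRing.addr0 GRing.fmorph_eq0.
have ghN1 (K : fieldType) (iota : {rmorphism F -> K}) :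
    (iota g + iota 0 != -1)%R.
  by rewrite -GRing.rmorphD GRing.addr0 -(GRing.rmorphN1 iota) (inj_eq (GRing.fmorph_inj _)).
have noroot (K : fieldType) (iota : {rmorphism F -> K}) (x : K) :
    (x ^+ #|F| = x -> x ^+ 2 - x - iota c != 0)%R.
  move=> /frob_fixed_in_image-/(_ iota)[a ->].
  by rewrite -GRing.rmorphXn -!GRing.rmorphB GRing.fmorph_eq0.
have irr : irreducible_elt (filling_poly #|F| g 0%R c).
  have [K [iota _]] := countable_algebraic_closure F.
  exact: (filling_poly_irreducible (char_K K iota) q_gt1 (frob_iota iota g)
    (frob_iota iota _) (frob_iota iota c) (ghN0 _ _) (ghN1 _ _) (@noroot _ iota)).
(* The conditions bear on g + h only, so h may be taken to be 0. *)
exists (filling_poly #|F| g 0%R c); split; [split|split; [|split]].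
- apply/eqP => f0; have [_ /(_ 0%R 0%R)] := irr.
  by rewrite f0 GRing.mulr0 => /(_ erefl) []; rewrite GRing.unitr0.
- apply: bihomogeneous_whomog.
    have -> : #|F| + 1 = #|F| * 1 + 1 + (#|F| * 0 + 0) by rewrite muln1 muln0 !addn0.
    by apply: whomog_filling_poly; rewrite /xweight coordsE.
  have -> : #|F| + 1 = #|F| * 0 + 0 + (#|F| * 1 + 1) by rewrite muln1 muln0.
  by apply: whomog_filling_poly; rewrite /yweight coordsE.
- move=> K iota _ i j p; rewrite map_filling_poly.
  exact: (filling_poly_smooth (char_K K iota) q_gt1 (frob_iota iota g)
    (frob_iota iota _) (frob_iota iota c) (ghN0 _ _) (ghN1 _ _) (@noroot _ iota)).
- exact: irr.
exact: filling_filling_poly.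
Qed.
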